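(* Let $\widehat m=(\widehat m_{ij})$ be the estimator $\widehat m_{ij}=\widehat m_{i\cdot}\,\widehat p_{ij}$ with $\widehat m_{i\cdot}=X_{i\cdot}/n$ (first-stage MLE from the present sample) and $\widehat p_i=(\widehat p_{ij})_j$ the MLE of the $i$-th second-stage model from the present sample. Then, as $n\to\infty$, its risk satisfies $$ \begin{aligned} \overset{-1}{ED}[\widehat m:m]&=\frac{p'}{2n}+\frac{1}{24n^2}\Bigl\{\sum_{i=1}^I m_{i\cdot}^{-1}\bigl(A_{(i)}+2\bigr)-2\Bigr\}+o(n^{-2})\\ &=\frac{1}{2n}\Bigl(I-1+\sum_{i=1}^I s_i\Bigr)+\frac{1}{12n^2}(M_f-1)+\frac{1}{24n^2}\sum_{i=1}^I m_{i\cdot}^{-1}A_{(i)}+o(n^{-2}), \end{aligned} $$ where $p'=I-1+\sum_{i=1}^I s_i$ and $M_f=\sum_{i=1}^I m_{i\cdot}^{-1}$. In the special case when all second-stage models are full models, $$ \overset{-1}{ED}[\widehat m:m]=\frac{p}{2n}+\frac{1}{12n^2}\Bigl\{\sum_{i=1}^I\sum_{j=1}^{J_i}m_{ij}^{-1}-1\Bigr\}+o(n^{-2}),\qquad p=\sum_{i=1}^I J_i-1 . $$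
   Context: Two-stage multinomial model. There are categories $C_{ij}$, $i=1,\dots,I$, $j=1,\dots,J_i$ ($J_i\ge 1$), with fixed true probabilities $m=(m_{ij})$, $m_{ij}>0$, $\sum_{i,j}m_{ij}=1$. Put $m_{i\cdot}=\sum_{j=1}^{J_i}m_{ij}$, $p_{ij}=m_{ij}/m_{i\cdot}$, $m_f=(m_{1\cdot},\dots,m_{I\cdot})$, $p_i=(p_{i1},\dots,p_{iJ_i})$. The first-stage model (for $m_f$) is a full model: no restriction other than positivity and summing to 1, so its dimension is $I-1$. The $i$-th second-stage model is a parametric model for $p_i$ (multinomial on the $J_i$ categories $C_{i1},\dots,C_{iJ_i}$, conditional on membership in $C_{i\cdot}=\bigcup_j C_{ij}$) of dimension $s_i\le J_i-1$; it is called full if $s_i=J_i-1$, i.e. no restriction on $p_i$ other than positivity and summing to 1. If $J_i=1$ then $p_{i1}=\widehat p_{i1}=1$ and there is no unknown parameter. Present survey: a random sample of size $n$ from this model, with counts $X_{ij}$ in $C_{ij}$, i.e. $(X_{ij})$ is multinomial with size $n$ and probabilities $(m_{ij})$; $X_{i\cdot}=\sum_j X_{ij}$. Second-stage estimator: $\widehat p_i=(\widehat p_{i1},\dots,\widehat p_{iJ_i})$ is the maximum likelihood estimator of $p_i$ in the $i$-th second-stage model based on $(X_{i1},\dots,X_{iJ_i})$, which conditionally on $X_{i\cdot}$ is a multinomial sample of size $X_{i\cdot}$ with probabilities $p_i$; for a full model $\widehat p_{ij}=X_{ij}/X_{i\cdot}$. Kullback–Leibler divergence and risk: for probability vectors,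 $\overset{-1}{D}[q:r]=\sum_k q_k\log(q_k/r_k)$ (with $0\log 0=0$), so $\overset{-1}{D}[\widehat m:m]=\sum_{i,j}\widehat m_{ij}\log(\widehat m_{ij}/m_{ij})$; the risk is $\overset{-1}{ED}[\widehat m:m]=E\bigl[\overset{-1}{D}[\widehat m:m]\bigr]$. Samples with some $X_{i\cdot}=0$ are discarded: expectations are taken conditionally on the event $X_{i\cdot}\ne0$ for all $1\le i\le I$. Coefficients $A_{(i)}$: $A_{(i)}$ denotes the coefficient of $1/(24n^2)$ in the asymptotic expansion of the risk of the MLE of the $i$-th second-stage model when that model is observed with a (non-random) sample size $n$; that is, the $i$-th second-stage model is such that, for the MLE $\widehat p_i$ based on a multinomial sample of size $n$ with probabilities $p_i$, $$E\bigl[\overset{-1}{D}[\widehat p_i:p_i]\bigr]=\frac{s_i}{2n}+\frac{1}{24n^2}A_{(i)}+o(n^{-2})\quad (n\to\infty).$$ *)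

(* Defs.v *)
From HB Require Import structures.
From mathcomp Require Import all_boot all_order all_algebra.
From mathcomp Require Import all_classical all_reals all_analysis.
Set Implicit Arguments.
Unset Strict Implicit.
Unset Printing Implicit Defensive.
Import Order.TTheory GRing.Theory Num.Theory.
Import numFieldNormedType.Exports.
Local Open Scope classical_set_scope.
Local Open Scope ring_scope.

Section Multinomial.
Variables (R : realType) (T : finType).
Implicit Types (q : T -> R) (x : T -> nat) (f : (T -> nat) -> R).

(* The sample size is the total count \sum_t x t. *)
Definition multinomial_pmf q x : R :=
  ((\sum_t x t)`!)%:R / (\prod_t (x t)`!)%:R * \prod_t q t ^+ x t.

(* E[f X] for X multinomial with size n and probabilities q; since no count
   exceeds n, the support is indexed by finite functions with values in
   'I_n.+1. *)
Definition multinomial_expectation q (n : nat) f : R :=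
  \sum_(x : {ffun T -> 'I_n.+1} | (\sum_t x t)%N == n)
     multinomial_pmf q (fun t => x t : nat) * f (fun t => x t : nat).

(* E[f X | A X], i.e. E[f X; A X] / P(A X). *)
Definition multinomial_cond_expectation q (n : nat) (A : pred (T -> nat)) f : R :=
  multinomial_expectation q n (fun x => (A x)%:R * f x) /
  multinomial_expectation q n (fun x => (A x)%:R).

(* The convention 0 * ln 0 = 0 is automatic; the divergence has its usual
   meaning when r is positive (or at least positive wherever q is). *)
Definition kl_div (q r : T -> R) : R := \sum_t q t * ln (q t / r t).

End Multinomial.

Section Models.
Variable R : realType.

Definition open_simplex (k : nat) : set 'rV[R]_k :=
  [set q | (forall j, 0 < q ord0 j) /\ \sum_j q ord0 j = 1].

(* A model is identified with its set of distributions; only continuity and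
   identifiability of the parametrization by an open set of R^s are required. *)
Definition parametric_model (k s : nat) (M : set 'rV[R]_k) : Prop :=
  M `<=` @open_simplex k /\
  exists (Theta : set 'rV[R]_s) (pi : 'rV[R]_s -> 'rV[R]_k),
    [/\ open Theta, Theta !=set0, {within Theta, continuous pi},
        set_inj Theta pi & pi @` Theta = M].

Definition full_model (k s : nat) (M : set 'rV[R]_k) : Prop :=
  s = k.-1 /\ M = @open_simplex k.

(* The likelihood is maximized over the closure of the model: with zero counts
   the maximum may only be reached on the boundary (in the full model it is
   reached at the empirical frequencies, which may vanish). *)
Definition is_mle (k : nat) (M : set 'rV[R]_k) (x : 'I_k -> nat)
    (q : 'rV[R]_k) : Prop :=
  closure M q /\
  forall q', closure M q' ->
    multinomial_pmf (q' ord0) x <= multinomial_pmf (q ord0) x.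

End Models.

Section TwoStage.
Variables (R : realType) (r : nat) (J : 'I_r -> nat).

Definition category : finType := {i : 'I_r & 'I_(J i)}.
Definition cell (i : 'I_r) (j : 'I_(J i)) : category :=
  Tagged (fun i => 'I_(J i)) j.

Implicit Type m : category -> R.

Definition marginal m (i : 'I_r) : R := \sum_(j < J i) m (cell j).

Definition conditional m (i : 'I_r) : 'rV[R]_(J i) :=
  \row_j (m (cell j) / marginal m i).

Definition subcounts (x : category -> nat) (i : 'I_r) : 'I_(J i) -> nat := fun j => x (cell j).
Definition group_count (x : category -> nat) (i : 'I_r) : nat := (\sum_(j < J i) x (cell j))%N.
Definition no_empty_group (x : category -> nat) : bool := [forall i, group_count x i != 0%N].

Variable phat : forall i : 'I_r, ('I_(J i) -> nat) -> 'rV[R]_(J i).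

Definition mhat (n : nat) (x : category -> nat) : category -> R := fun c =>
  (group_count x (tag c))%:R / n%:R *
  phat (subcounts x (i := tag c)) ord0 (tagged c).

Definition two_stage_risk m (n : nat) : R :=
  multinomial_cond_expectation m n no_empty_group
    (fun x => kl_div (mhat n x) m).

(* Risk of phat i for a non-random sample size n and true probabilities p. *)
Definition stage_risk (i : 'I_r) (p : 'rV[R]_(J i)) (n : nat) : R :=
  multinomial_expectation (p ord0) n
    (fun x => kl_div (phat x ord0) (p ord0)).

End TwoStage.

(* Main.v *)
Require Import Defs.
From mathcomp Require Import all_boot all_order all_algebra.
From mathcomp Require Import all_classical all_reals all_analysis.
From mathcomp Require Import ring lra zify.
Import Order.TTheory GRing.Theory Num.Theory.
Import numFieldNormedType.Exports.
Set Implicit Arguments.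
Unset Strict Implicit.
Unset Printing Implicit Defensive.
Local Open Scope classical_set_scope.
Local Open Scope ring_scope.

(** Write N_i for the total count of group i, mu_i for its probability and p_i
    for the conditional probabilities inside it. The chain rule for the
    divergence ([kl_div_mhat]) gives, sample by sample,

      D(mhat : m) = \sum_i (N_i / n) ln (N_i / (n mu_i))
                    + \sum_i (N_i / n) D(phat_i : p_i).

    N_i is binomial and, given N_i = k, the counts of group i are multinomial of
    size k ([multinomial_expectation_block]). Hence the expectation of both sums
    is a combination of binomial expectations, the second one involving only the
    risk of phat_i at the fixed sample size k.

    First sum. With N_i = n mu_i (1 + u), each term is mu_i (1 + u) ln (1 + u).
    This function lies between its Taylor polynomial of degree 5 and that
    polynomial plus u ^ 6 / 5 on the whole half-line u >= -1 ([xlnx_ge],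
    [xlnx_le]); integrating the two bounds needs only the central moments of
    order at most 6, and no tail estimate. The result is
    (1 - mu_i) / (2 n) + (1 / mu_i - mu_i) / (12 n ^ 2) + O(n ^ -3)
    ([binomial_xlnx_risk]).

    Second sum. If the risk at size k is a / k + b / k ^ 2 + o(k ^ -2), weighting
    by k / n and averaging gives a / n + (b / n) E[1 / N_i] + o(n ^ -2), that is
    a / n + b / (mu_i n ^ 2) + o(n ^ -2) ([binomial_weighted_risk]). Its tool is
    the size-bias identity E[N g(N)] = n mu E[g(N' + 1)], N' binomial of size
    n - 1, which yields all the inverse moments that occur.

    Conditioning on the absence of empty groups is harmless, since the divergence
    is bounded and the excluded event has probability O(n ^ -3)
    ([negligible_conditioning]).

    For full models the maximum likelihood estimator is the vector of observed
    frequencies ([mle_full_model]), so its risk is a sum over categories of terms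
    of the first kind ([full_model_risk]); this provides the coefficients A_i to
    be inserted in the general expansion. *)

(** * Multinomial expectations *)

Section MultinomialExpectation.
Variables (R : realType) (T : finType).
Implicit Types (q : T -> R) (f g : (T -> nat) -> R) (x : T -> nat).

Lemma eq_multinomial_expectation q n f g :
    (forall x, (\sum_t x t)%N = n -> f x = g x) ->
  multinomial_expectation q n f = multinomial_expectation q n g.
Proof. by move=> fg; apply: eq_bigr => x /eqP sx; rewrite fg. Qed.

Lemma multinomial_expectationD q n f g :
  multinomial_expectation q n (fun x => f x + g x) =
  multinomial_expectation q n f + multinomial_expectation q n g.
Proof. by rewrite -big_split; apply: eq_bigr => x _; rewrite mulrDr. Qed.

Lemma multinomial_expectationZ q n (a : R) f :
  multinomial_expectation q n (fun x => a * f x) =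
  a * multinomial_expectation q n f.
Proof. by rewrite mulr_sumr; apply: eq_bigr => x _; rewrite mulrCA. Qed.

Lemma multinomial_expectation_sum q n (I : finType) (F : I -> (T -> nat) -> R) :
  multinomial_expectation q n (fun x => \sum_i F i x) =
  \sum_i multinomial_expectation q n (F i).
Proof. by rewrite exchange_big; apply: eq_bigr => x _; rewrite mulr_sumr. Qed.

Lemma multinomial_pmf_ge0 q x : (forall t, 0 <= q t) -> 0 <= multinomial_pmf q x.
Proof.
move=> q0; rewrite mulr_ge0 ?divr_ge0 ?ler0n //.
by apply: prodr_ge0 => t _; rewrite exprn_ge0.
Qed.

Lemma le_multinomial_expectation q n f g :
    (forall t, 0 <= q t) ->
    (forall x, (\sum_t x t)%N = n -> f x <= g x) ->
  multinomial_expectation q n f <= multinomial_expectation q n g.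
Proof.
move=> q0 fg; apply: ler_sum => x /eqP sx.
by rewrite ler_wpM2l ?fg ?multinomial_pmf_ge0.
Qed.

Definition add_count (t : T) x : T -> nat := fun u => (x u + (u == t))%N.

(** The multinomial coefficient of x is the sum over t of those of x minus one
    observation in t, because n`! * (x_1 + ... + x_k) = (n + 1)`!. *)
Lemma multinomial_pmf_draw q n x :
    (\sum_t x t)%N = n.+1 ->
  multinomial_pmf q x =
  \sum_(t | (0 < x t)%N) q t * multinomial_pmf q (fun u => (x u - (u == t))%N).
Proof.
move=> sx.
have prodf t : (0 < x t)%N ->
    (\prod_u (x u)`! = x t * \prod_u (x u - (u == t))`!)%N.
  move=> xt; rewrite (bigD1 t) //= [in RHS](bigD1 t) //= eqxx subn1.
  rewrite mulnA -{1}(prednK xt) factS prednK //; congr (_ * _)%N.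
  by apply: eq_bigr => u /negPf ->; rewrite subn0.
have prodq t : (0 < x t)%N ->
    \prod_u q u ^+ x u = q t * \prod_u q u ^+ (x u - (u == t)).
  move=> xt; rewrite (bigD1 t) //= [in RHS](bigD1 t) //= eqxx subn1.
  rewrite mulrA -exprS prednK //; congr (_ * _).
  by apply: eq_bigr => u /negPf ->; rewrite subn0.
have sumx t : (0 < x t)%N -> (\sum_u (x u - (u == t)) = n)%N.
  move=> xt; apply/succn_inj; rewrite -sx (bigD1 t) //= [in RHS](bigD1 t) //=.
  rewrite eqxx subn1 -addSn prednK //; congr (_ + _)%N.
  by apply: eq_bigr => u /negPf ->; rewrite subn0.
rewrite /multinomial_pmf sx.
transitivity (\sum_(t | (0 < x t)%N)
    (x t)%:R * (n`!%:R / (\prod_u (x u)`!)%:R * \prod_u q u ^+ x u)).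
  rewrite -mulr_suml -natr_sum.
  have -> : (\sum_(t | 0 < x t) x t = n.+1)%N.
    rewrite -sx [RHS](bigID (fun t => 0 < x t)%N) /= [X in (_ + X)%N]big1 ?addn0 //.
    by move=> t; rewrite lt0n negbK => /eqP.
  by rewrite factS natrM !mulrA.
apply: eq_bigr => t xt; rewrite sumx // (prodf t xt) (prodq t xt) natrM.
have xt0 : (x t)%:R != 0 :> R by rewrite pnatr_eq0 -lt0n.
have p0 : (\prod_u (x u - (u == t))`!)%:R != 0 :> R.
  by rewrite pnatr_eq0 -lt0n prodn_gt0 // => u; rewrite fact_gt0.
by field; rewrite xt0 p0.
Qed.

(** A multinomial sample of size n+1 is one draw followed by a sample of size n;
    every exact formula below is an induction on the sample size. *)
Lemma multinomial_expectationS q n f :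
  multinomial_expectation q n.+1 f =
  \sum_t q t * multinomial_expectation q n (fun x => f (add_count t x)).
Proof.
rewrite /multinomial_expectation.
under eq_bigr => x /eqP sx.
  rewrite (multinomial_pmf_draw q sx) mulr_suml big_mkcond /=.
  over.
rewrite exchange_big /=; apply: eq_bigr => t _.
rewrite mulr_sumr -big_mkcondr /=.
pose dn (x : {ffun T -> 'I_n.+2}) : {ffun T -> 'I_n.+1} :=
  [ffun u => inord (x u - (u == t))].
pose up (y : {ffun T -> 'I_n.+1}) : {ffun T -> 'I_n.+2} :=
  [ffun u => inord (y u + (u == t))].
have upE y u : up y u = (y u + (u == t))%N :> nat.
  rewrite ffunE inordK //; have := ltn_ord (y u).
  by case: (u == t) => yu; rewrite ?addn1 ?addn0 // ltnW.
have dnE (x : {ffun T -> 'I_n.+2}) u : (\sum_t x t == n.+1)%N -> (0 < x t)%N ->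
    dn x u = (x u - (u == t))%N :> nat.
  move=> /eqP sx xt; rewrite ffunE inordK //.
  have [->|ut] := eqVneq u t.
    by rewrite subn1 prednK // -ltnS ltn_ord.
  have : (x u + x t <= \sum_t x t)%N.
    rewrite (bigD1 t) //= (bigD1 u) //= addnA.
    by apply: leq_trans (leq_addr _ _); rewrite addnC.
  by rewrite sx subn0 -(prednK xt) addnS ltnS; exact: leq_trans (leq_addr _ _).
rewrite (reindex_onto up dn) /=; last first.
  move=> x /andP[sx xt]; apply/ffunP => u; apply/ord_inj; rewrite upE dnE // subnK //.
  by case: eqP => // ->.
apply: eq_big => [y|y _].
  have -> : (\sum_u up y u = (\sum_u y u).+1)%N.
    under eq_bigr => u _ do rewrite upE.
    rewrite big_split /= [X in (_ + X)%N](bigD1 t) //= eqxx.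
    rewrite [X in (true + X)%N]big1 ?addn1 //.
    by move=> u /negPf ->.
  rewrite eqSS upE eqxx addn1 /=.
  have -> : dn (up y) == y; last by rewrite !andbT.
  by apply/eqP/ffunP => u; apply/ord_inj; rewrite ffunE upE addnK inordK.
rewrite mulrA; congr (_ * multinomial_pmf _ _ * f _); apply/funext => u.
  by rewrite upE addnK.
by rewrite upE.
Qed.

Lemma multinomial_expectation0 q f :
  multinomial_expectation q 0 f = f (fun=> 0%N).
Proof.
rewrite /multinomial_expectation (big_pred1 [ffun=> ord0]); last first.
  move=> x /=; rewrite sum_nat_eq0; apply/forallP/eqP => [x0|-> t]; last first.
    by rewrite ffunE.
  by apply/ffunP => t; apply/ord_inj; rewrite ffunE; apply/eqP; exact: x0.
have -> : (fun t => nat_of_ord ([ffun=> ord0] t : 'I_1)) = (fun=> 0%N) :> (T -> nat).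
  by apply/funext => t; rewrite ffunE.
by rewrite /multinomial_pmf !big1 //= ?invr1 ?mulr1 ?mul1r // => t _; rewrite ?fact0.
Qed.

Lemma multinomial_expectation_cst q n (c : R) :
  \sum_t q t = 1 -> multinomial_expectation q n (fun=> c) = c.
Proof.
move=> q1; elim: n => [|n IHn]; first by rewrite multinomial_expectation0.
by rewrite multinomial_expectationS -mulr_suml q1 mul1r IHn.
Qed.

Lemma multinomial_expectation_norm_le q n f (C : R) :
    (forall t, 0 <= q t) -> \sum_t q t = 1 ->
    (forall x, (\sum_t x t)%N = n -> `|f x| <= C) ->
  `|multinomial_expectation q n f| <= C.
Proof.
move=> q0 q1 fC; have cstE := @multinomial_expectation_cst q n _ q1.
rewrite ler_norml; apply/andP; split.
  rewrite -(cstE (- C)); apply: le_multinomial_expectation => // x /fC.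
  by rewrite ler_norml => /andP[].
rewrite -(cstE C); apply: le_multinomial_expectation => // x /fC.
by rewrite ler_norml => /andP[].
Qed.

End MultinomialExpectation.

(** * Binomial expectations and blocks of categories *)

(** The expectation of g (N), N binomial of size n and parameter mu, computed
    one trial at a time; identities and bounds for it then follow by induction
    without manipulating binomial coefficients. *)
Fixpoint binomial_expectation (R : realType) (mu : R) (n : nat) (g : nat -> R) : R :=
  if n is n'.+1 then (1 - mu) * binomial_expectation mu n' g +
    mu * binomial_expectation mu n' (fun k => g k.+1)
  else g 0%N.

Section BinomialExpectation.
Variables (R : realType) (mu : R).
Implicit Types (f g : nat -> R).

Lemma binomial_expectationS n f :
  binomial_expectation mu n.+1 f = (1 - mu) * binomial_expectation mu n f +
    mu * binomial_expectation mu n (fun k => f k.+1).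
Proof. by []. Qed.

Lemma binomial_expectationD n f g :
  binomial_expectation mu n (fun k => f k + g k) =
  binomial_expectation mu n f + binomial_expectation mu n g.
Proof. by elim: n f g => //= n IHn f g; rewrite !IHn; ring. Qed.

Lemma binomial_expectationZ n (a : R) f :
  binomial_expectation mu n (fun k => a * f k) = a * binomial_expectation mu n f.
Proof. by elim: n f => //= n IHn f; rewrite !IHn; ring. Qed.

Lemma binomial_expectation_cst n (c : R) : binomial_expectation mu n (fun=> c) = c.
Proof. by elim: n => //= n ->; ring. Qed.

Lemma binomial_expectation_sum n (I : finType) (P : pred I) (F : I -> nat -> R) :
  binomial_expectation mu n (fun k => \sum_(i | P i) F i k) =
  \sum_(i | P i) binomial_expectation mu n (F i).
Proof.
by elim: n F => //= n IHn F; rewrite !IHn !mulr_sumr -big_split.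
Qed.

Hypothesis mu01 : 0 <= mu <= 1.

Lemma le_binomial_expectation n f g :
    (forall k, f k <= g k) ->
  binomial_expectation mu n f <= binomial_expectation mu n g.
Proof.
have /andP[mu0 mu1] := mu01.
elim: n f g => [|n IHn] f g fg //=.
by rewrite lerD // ler_wpM2l ?subr_ge0 //; apply: IHn.
Qed.

Lemma binomial_expectation_norm_le n f :
  `|binomial_expectation mu n f| <= binomial_expectation mu n (fun k => `|f k|).
Proof.
rewrite ler_norml; apply/andP; split; last first.
  by apply: le_binomial_expectation => k; exact: ler_norm.
rewrite -mulN1r -binomial_expectationZ; apply: le_binomial_expectation => k.
by rewrite mulN1r lerNl -normrN ler_norm.
Qed.

End BinomialExpectation.

(** Induction on the sample size: a draw outside the block, of probability
    1 - mu, leaves f unchanged, and a draw inside it is a draw from the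
    conditional probabilities. With S a single point this says that the count of
    one category is binomial. *)
Lemma multinomial_expectation_block (R : realType) (S T : finType) (h : S -> T)
    (q : T -> R) (n : nat) (f : (S -> nat) -> R) :
    injective h -> \sum_t q t = 1 -> \sum_s q (h s) != 0 ->
  multinomial_expectation q n (fun x => f (x \o h)) =
  binomial_expectation (\sum_s q (h s)) n
    (fun k => multinomial_expectation (fun s => q (h s) / \sum_s q (h s)) k f).
Proof.
move=> hI q1; set mu := \sum_s _ => mu0.
have muE : \sum_(t in [set h s | s in S]%SET) q t = mu.
  by rewrite big_imset //= => s s' _ _ /hI.
elim: n f => [|n IHn] f; first by rewrite /= !multinomial_expectation0.
rewrite multinomial_expectationS /= (bigID (mem [set h s | s in S]%SET)) /= addrC.
congr (_ + _).
  have <- : \sum_(t | t \notin [set h s | s in S]%SET) q t = 1 - mu.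
    by rewrite -q1 -muE [X in _ = X - _](bigID (mem [set h s | s in S]%SET)) /= addrC addrK.
  rewrite mulr_suml; apply: eq_bigr => t tS; rewrite -IHn; congr (_ * _).
  apply: eq_multinomial_expectation => x _; congr f; apply/funext => s.
  rewrite /= /add_count; case: eqP => [hst|]; last by rewrite addn0.
  by case/negP: tS; apply/imsetP; exists s.
rewrite big_imset /=; last by move=> s s' _ _ /hI.
transitivity (\sum_s q (h s) * binomial_expectation mu n (fun k =>
    multinomial_expectation (fun s => q (h s) / mu) k (fun x => f (add_count s x)))).
  apply: eq_bigr => s _; rewrite -IHn; congr (_ * _).
  apply: eq_multinomial_expectation => x _; congr f; apply/funext => u.
  by rewrite /= /add_count (inj_eq hI).
under eq_bigr do rewrite -binomial_expectationZ.
rewrite -binomial_expectation_sum -binomial_expectationZ.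
congr binomial_expectation; apply/funext => k.
rewrite multinomial_expectationS mulr_sumr; apply: eq_bigr => s _.
by rewrite mulrA mulrCA divff // mulr1.
Qed.

(** * Inverse moments of binomial variables *)

Section BinomialMoments.
Variables (R : realType) (mu : R).
Hypothesis mu01 : 0 < mu <= 1.
Let mu_gt0 : 0 < mu. Proof. by case/andP: mu01. Qed.
Let mu_ne0 : mu != 0. Proof. by rewrite gt_eqF. Qed.
Let mu01w : 0 <= mu <= 1. Proof. by case/andP: mu01 => /ltW -> ->. Qed.

(** Size bias: a factor N is traded for the constant n mu and a shift of the
    argument. Read from right to left, this removes a factor (N + 1)^-1. *)
Lemma binomial_expectation_size_bias n (g : nat -> R) :
  binomial_expectation mu n.+1 (fun k => k%:R * g k) =
  n.+1%:R * mu * binomial_expectation mu n (fun k => g k.+1).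
Proof.
elim: n g => [|n IHn] g; first by rewrite /=; ring.
rewrite binomial_expectationS.
have -> : (fun k => k.+1%:R * g k.+1) = (fun k => k%:R * g k.+1 + g k.+1).
  by apply/funext => k; rewrite -natr1 mulrDl mul1r.
rewrite binomial_expectationD (IHn g) (IHn (fun k => g k.+1)).
rewrite (binomial_expectationS mu n (fun k => g k.+1)) -[n.+2%:R]natr1; ring.
Qed.

(** By size bias each factor (k + 1)^-1 contributes (mu (n + 1))^-1, at the price
    of a shift of k that k + 2 <= 2 (k + 1) undoes; this last inequality is where
    the powers of 2 come from. *)
Lemma inverse_moment_le j n :
  binomial_expectation mu n (fun k => k.+1%:R ^- j) <= (2 ^+ j / (mu * n.+1%:R)) ^+ j.
Proof.
elim: j n => [|j IHj] n.
  rewrite expr0; under eq_fun do rewrite expr0 invr1.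
  by rewrite binomial_expectation_cst.
have n0 k : 0 < k.+1%:R :> R by rewrite ltr0n.
have -> : binomial_expectation mu n (fun k => k.+1%:R ^- j.+1) =
    (mu * n.+1%:R)^-1 *
    binomial_expectation mu n.+1 (fun k => k%:R * k%:R ^- j.+1).
  rewrite (binomial_expectation_size_bias n (fun k => k%:R ^- j.+1)).
  by rewrite [n.+1%:R * _]mulrC mulKf // mulf_neq0 // gt_eqF.
have m0 k : 0 < mu * k.+1%:R by rewrite mulr_gt0.
apply: (@le_trans _ _ ((mu * n.+1%:R)^-1 * (2 ^+ j * (2 ^+ j / (mu * n.+2%:R)) ^+ j))).
  rewrite ler_wpM2l ?invr_ge0 ?(ltW (m0 _)) //.
  apply: le_trans (ler_wpM2l _ (IHj n.+1)); last by rewrite exprn_ge0.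
  rewrite -binomial_expectationZ; apply: le_binomial_expectation => //= -[|k].
    by rewrite mul0r mulr_ge0 ?invr_ge0 ?exprn_ge0.
  rewrite exprS invfM mulVKf ?gt_eqF // -!exprVn -exprMn.
  have le2 : k.+1%:R^-1 <= 2 * k.+2%:R^-1 :> R.
    rewrite -[X in X <= _]mul1r ler_pdivrMr // mulrAC ler_pdivlMr // mul1r -natrM.
    by rewrite ler_nat; lia.
  by rewrite lerXn2r ?nnegrE // ?invr_ge0 ?mulr_ge0 ?invr_ge0.
rewrite [leRHS]exprS [leRHS]mulrAC [leRHS]mulrC ler_wpM2l ?invr_ge0 ?(ltW (m0 _)) //.
have le2 : 2 ^+ j <= 2 ^+ j.+1 :> R by rewrite ler_weXn2l // ler1n.
rewrite ler_pM ?exprn_ge0 // ?divr_ge0 ?exprn_ge0 ?(ltW (m0 _)) //.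
rewrite lerXn2r ?nnegrE ?divr_ge0 ?exprn_ge0 ?(ltW (m0 _)) //.
rewrite ler_pM ?exprn_ge0 // ?invr_ge0 ?(ltW (m0 _)) //.
by rewrite lef_pV2 ?posrE // ler_pM2l // ler_nat.
Qed.

Lemma inverse_moment_bound j : exists2 C : R, 0 < C &
  forall n, binomial_expectation mu n (fun k => k.+1%:R ^- j) <= C / n.+1%:R ^+ j.
Proof.
exists ((2 ^+ j / mu) ^+ j) => [|n]; first by rewrite exprn_gt0 ?divr_gt0 ?exprn_gt0.
by apply: le_trans (inverse_moment_le j n) _; rewrite invfM mulrA exprMn exprVn.
Qed.

Lemma binomial_expectation_eq0 n :
  binomial_expectation mu n (fun k => (k == 0)%:R) = (1 - mu) ^+ n.
Proof.
elim: n => //= n ->.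
by rewrite (binomial_expectation_cst mu n 0) mulr0 addr0 exprS.
Qed.

(** P(N = 0) is at most the inverse moment of order 3; of its exponential decay
    only the order n ^ -3 matters here. *)
Lemma binomial_eq0_bound : exists2 C : R, 0 < C &
  forall n, (1 - mu) ^+ n <= C / n.+1%:R ^+ 3.
Proof.
have [C C0 Cn] := inverse_moment_bound 3; exists C => // n.
rewrite -binomial_expectation_eq0; apply: le_trans (Cn n).
apply: le_binomial_expectation => // -[|k] /=; first by rewrite expr1n invr1.
by rewrite invr_ge0 exprn_ge0.
Qed.

Lemma inverse_moment1 n :
  binomial_expectation mu n (fun k => k.+1%:R^-1) =
  (1 - (1 - mu) ^+ n.+1) / (mu * n.+1%:R).
Proof.
have n0 : n.+1%:R != 0 :> R by rewrite pnatr_eq0.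
apply: (canRL (mulfK _)); first by rewrite mulf_neq0.
rewrite mulrC [mu * _]mulrC -(binomial_expectation_size_bias n (fun k => k%:R^-1)).
transitivity (binomial_expectation mu n.+1 (fun k => 1 + -1 * (k == 0)%:R)).
  congr binomial_expectation; apply/funext => -[|k] /=.
    by rewrite mul0r mulN1r subrr.
  by rewrite divff ?pnatr_eq0 // mulr0 addr0.
rewrite binomial_expectationD binomial_expectationZ binomial_expectation_cst.
by rewrite binomial_expectation_eq0 mulN1r.
Qed.

(** Size bias reduces the second inverse moment to E[N^-1; N > 0], which differs
    from the explicitly known E[(N + 1)^-1] by at most 2 E[(N + 1)^-2]. *)
Lemma inverse_moment2 : exists C : R, forall n,
  `|binomial_expectation mu n (fun k => k.+1%:R ^- 2) - (mu * n.+1%:R) ^- 2|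
    <= C / n.+1%:R ^+ 3.
Proof.
have [C2 C20 C2n] := inverse_moment_bound 2.
have [C3 C30 C3n] := binomial_eq0_bound.
exists (2 * C2 / mu + C3 / mu ^+ 2 + mu ^- 2) => n.
set N : R := n.+1%:R.
have N0 : 0 < N by rewrite ltr0n.
have N1 : 1 <= N by rewrite ler1n.
have -> : binomial_expectation mu n (fun k => k.+1%:R ^- 2) = (mu * N)^-1 *
    binomial_expectation mu n.+1 (fun k => k%:R * k%:R ^- 2).
  rewrite (binomial_expectation_size_bias n (fun k => k%:R ^- 2)).
  by rewrite -/N [N * _]mulrC mulKf // mulf_neq0 // gt_eqF.
have -> : binomial_expectation mu n.+1 (fun k => k%:R * k%:R ^- 2) =
    binomial_expectation mu n.+1 (fun k => k.+1%:R^-1) +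
    binomial_expectation mu n.+1 (fun k => k%:R * k%:R ^- 2 - k.+1%:R^-1).
  rewrite -binomial_expectationD; congr binomial_expectation.
  by apply/funext => k; rewrite addrC subrK.
rewrite inverse_moment1; set D := binomial_expectation _ _ _.
have DC : `|D| <= 2 * (C2 / N ^+ 2).
  apply: le_trans (binomial_expectation_norm_le mu01w _ _) _.
  apply: le_trans (_ : 2 * (C2 / n.+2%:R ^+ 2) <= _); last first.
    rewrite !ler_wpM2l ?(ltW C20) // lef_pV2 ?posrE ?exprn_gt0 //.
    by rewrite lerXn2r ?nnegrE // ler_nat.
  apply: le_trans (ler_wpM2l _ (C2n n.+1)) => //.
  rewrite -binomial_expectationZ; apply: le_binomial_expectation => // -[|k].
    by rewrite mul0r sub0r normrN invr1 normr1 expr1n invr1 mulr1 ler1n.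
  have k1 : 0 < k.+1%:R :> R by [].
  have k2 : k.+2%:R = k.+1%:R + 1 :> R by rewrite natr1.
  have -> : k.+1%:R * k.+1%:R ^- 2 - k.+2%:R^-1 = (k.+1%:R * k.+2%:R)^-1 :> R.
    rewrite k2; move: (k.+1%:R : R) k1 => a a0.
    by field; rewrite !gt_eqF // addr_gt0.
  rewrite ger0_norm ?invr_ge0 ?mulr_ge0 // -[X in X <= _]mul1r.
  rewrite ler_pdivrMr ?mulr_gt0 // mulrAC ler_pdivlMr ?exprn_gt0 // mul1r -!natrX.
  by rewrite -!natrM ler_nat; lia.
clearbody D; have qC : `|(1 - mu) ^+ n.+2| <= C3 / N ^+ 3.
  have /andP[_ mu1] := mu01; rewrite ger0_norm ?exprn_ge0 ?subr_ge0 //.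
  apply: le_trans (C3n n.+2) _.
  rewrite ler_wpM2l ?(ltW C30) // lef_pV2 ?posrE ?exprn_gt0 //.
  by rewrite lerXn2r ?nnegrE // ler_nat; lia.
have N20 : 0 < N + 1 by rewrite addr_gt0.
have -> : (mu * N)^-1 * ((1 - (1 - mu) ^+ n.+2) / (mu * n.+2%:R) + D) - (mu * N) ^- 2
   = D * (mu * N)^-1 + - (1 - mu) ^+ n.+2 * (mu ^- 2 * (N * (N + 1))^-1)
     + - (mu ^- 2 * (N ^+ 2 * (N + 1))^-1).
  have -> : n.+2%:R = N + 1 :> R by rewrite natr1.
  by field; rewrite mu_ne0 !gt_eqF.
have m2 : 0 < mu ^- 2 by rewrite invr_gt0 exprn_gt0.
have [/ltW C20w /ltW C30w] := (C20, C30).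
rewrite !mulrDl; apply: le_trans (ler_normD _ _) (lerD _ _); last first.
  rewrite normrN ger0_norm ?mulr_ge0 ?invr_ge0 ?exprn_ge0 ?mulr_ge0 ?exprn_ge0
    ?(ltW N0) ?(ltW N20) ?(ltW mu_gt0) //.
  rewrite ler_pM2l // lef_pV2 ?posrE ?exprn_gt0 ?mulr_gt0 ?exprn_gt0 //.
  by rewrite [leLHS]exprSr ler_pM2l ?exprn_gt0 // lerDl.
apply: le_trans (ler_normD _ _) (lerD _ _).
  have mN : 0 <= (mu * N)^-1 by rewrite invr_ge0 mulr_ge0 ?ltW.
  rewrite normrM (ger0_norm mN).
  apply: (@le_trans _ _ (2 * (C2 / N ^+ 2) * (mu * N)^-1)).
    by rewrite ler_wpM2r.
  by rewrite le_eqVlt; apply/orP; left; apply/eqP; field; rewrite mu_ne0 gt_eqF.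
rewrite normrM normrN [X in _ * X <= _]ger0_norm; last first.
  by rewrite mulr_ge0 ?invr_ge0 ?mulr_ge0 ?exprn_ge0 // ltW.
apply: (@le_trans _ _ (C3 / N ^+ 3 * mu ^- 2)); last by rewrite mulrAC.
apply: ler_pM => //; first by rewrite mulr_ge0 ?invr_ge0 ?mulr_ge0 ?exprn_ge0 // ltW.
rewrite ler_piMr ?ltW // invf_lt1 ?mulr_gt0 //.
by rewrite (le_lt_trans N1) // ltr_pMr // ltrDr.
Qed.

End BinomialMoments.

(** * Sequences negligible with respect to n ^- 2 *)

Section Negligible.
Variable R : realType.
Implicit Types (d e : nat -> R).

(** Being o(n ^- 2), phrased as a bound that holds at every n >= 1: the finitely
    many exceptional indices are absorbed by the constant C. Such a bound can be
    integrated against the law of a random sample size. *)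
Definition negligible d := forall eps : R, 0 < eps ->
  exists C : R, forall n, `|d n.+1| <= eps / n.+1%:R ^+ 2 + C / n.+1%:R ^+ 3.

Lemma eq_negligible d e : (forall n, d n.+1 = e n.+1) -> negligible d -> negligible e.
Proof. by move=> de nd eps /nd[C dC]; exists C => n; rewrite -de. Qed.

Lemma negligible_cubic (C : R) d :
  (forall n, `|d n.+1| <= C / n.+1%:R ^+ 3) -> negligible d.
Proof.
move=> dC eps eps0; exists C => n; apply: le_trans (dC n) _.
by rewrite lerDr divr_ge0 ?exprn_ge0 // ltW.
Qed.

Lemma negligibleD d e :
  negligible d -> negligible e -> negligible (fun n => d n + e n).
Proof.
move=> nd ne eps eps0; have eps2 : 0 < eps / 2 by rewrite divr_gt0.
have [[C dC] [C' eC]] := (nd _ eps2, ne _ eps2); exists (C + C') => n.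
apply: le_trans (ler_normD _ _) _; apply: le_trans (lerD (dC n) (eC n)) _.
by rewrite addrACA -mulrDl -splitr -mulrDl.
Qed.

Lemma negligible0 : negligible (fun=> 0).
Proof. by apply: (@negligible_cubic 0) => n; rewrite normr0 mul0r. Qed.

Lemma negligible_sum (I : finType) (d : I -> nat -> R) :
  (forall i, negligible (d i)) -> negligible (fun n => \sum_i d i n).
Proof.
move=> nd; have -> : (fun n => \sum_i d i n) = \sum_i d i.
  by apply/funext => n; rewrite fct_sumE.
by apply: big_ind => //; [exact: negligible0 | exact: negligibleD].
Qed.

Lemma negligibleP (f g : nat -> R) :
  f = g +o_\oo (fun n : nat => n%:R ^- 2 : R) <-> negligible (fun n => f n - g n).
Proof.
rewrite eqaddoP; split=> [fg eps eps0|nfg eps eps0].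
  have [N _ fgN] := fg _ eps0.
  (* C dominates the finitely many terms that precede the rank N. *)
  pose C := \sum_(k < N) `|f k - g k| * k%:R ^+ 3.
  exists C => n; have [Nn|nN] := leqP N n.+1.
    apply: le_trans (fgN _ Nn) _.
    rewrite normrV ?unitfE ?expf_neq0 // ger0_norm ?exprn_ge0 // lerDl.
    by rewrite divr_ge0 ?exprn_ge0 //; apply: sumr_ge0 => k _; rewrite mulr_ge0 ?exprn_ge0.
  rewrite -[X in X <= _]add0r lerD ?divr_ge0 ?exprn_ge0 ?(ltW eps0) //.
  rewrite ler_pdivlMr ?exprn_gt0 // /C (bigD1 (Ordinal nN)) //= lerDl.
  by apply: sumr_ge0 => k _; rewrite mulr_ge0 ?exprn_ge0.
have [C nC] := nfg _ (divr_gt0 eps0 (ltr0n R 2)).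
near=> n; have n0 : (0 < n)%N by near: n; exact: nbhs_infty_gt.
rewrite -(prednK n0); apply: le_trans (nC _) _; rewrite prednK //.
have nR : 0 < n%:R :> R by rewrite ltr0n.
rewrite normrV ?unitfE ?expf_neq0 ?gt_eqF // ger0_norm ?exprn_ge0 //.
have nC2 : 2 * C / eps <= n%:R by near: n; exact: nbhs_infty_ger.
rewrite [in leRHS](splitr eps) mulrDl lerD2l ler_pdivrMr ?exprn_gt0 //.
have -> : eps / 2 / n%:R ^+ 2 * n%:R ^+ 3 = eps / 2 * n%:R by field; rewrite gt_eqF.
by move: nC2; rewrite ler_pdivrMr // => nC2; lra.
Unshelve. all: by end_near. Qed.

End Negligible.

(** * Polynomial bounds for t ln t *)

Section XlnX.
Variable R : realType.

(** F decreases before 1 and increases after it, so F 1 = 0 is its minimum. *)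
Lemma ge0_of_derive_sign (F dF : R -> R) :
    (forall t : R, 0 < t -> is_derive t 1 F (dF t)) ->
    (forall t, 0 < t -> 0 <= (t - 1) * dF t) -> F 1 = 0 ->
  forall t, 0 < t -> 0 <= F t.
Proof.
move=> FdF dF_sign F1 t t0.
have cF (x : R) : 0 < x -> {for x, continuous F}.
  by move=> x0; apply/differentiable_continuous/derivable1_diffP; case: (FdF x x0).
have mvt a b : 0 < a -> a < b -> exists2 c, a < c < b & F b - F a = dF c * (b - a).
  move=> a0 ab; have [x|x|c] := @MVT R F dF a b ab.
  - by rewrite in_itv /= => /andP[ax _]; apply: FdF; exact: lt_trans ax.
  - apply: continuous_in_subspaceT => y; rewrite inE /= in_itv /= => /andP[ay _].
    by apply: cF; exact: lt_le_trans ay.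
  - by rewrite in_itv /= => cab FE; exists c.
have [t1|t1|->] := ltgtP t 1; last by rewrite F1.
  have [c /andP[tc c1] FE] := mvt _ _ t0 t1.
  have := dF_sign c (lt_trans t0 tc).
  by move: FE; rewrite F1; nra.
have [c /andP[c1 ct] FE] := mvt _ _ ltr01 t1.
have := dF_sign c (lt_trans ltr01 c1).
by move: FE; rewrite F1; nra.
Qed.

(** The Taylor polynomial of degree 5 of (1 + u) ln (1 + u) at u = 0. *)
Definition xlnx_poly (u : R) :=
  u + u ^+ 2 / 2 - u ^+ 3 / 6 + u ^+ 4 / 12 - u ^+ 5 / 20.

Lemma is_derive_inv (x : R) : x != 0 -> is_derive x 1 (fun y : R => y^-1) (- x ^- 2).
Proof.
move=> x0; have did := @derivable_id R R x 1.
have := @deriveV R R id x 1 x0 did.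
rewrite derive_id scaler1 => <-.
by apply/derivableP; exact: derivableV.
Qed.

(** The difference divided by t is F t = ln t - xlnx_poly (t - 1) / t, whose
    derivative (t - 1) ^ 5 / (5 t ^ 2) has the sign of t - 1. *)
Lemma xlnx_ge (t : R) : 0 <= t -> xlnx_poly (t - 1) <= t * ln t.
Proof.
rewrite le_eqVlt => /orP[/eqP <-|t0]; first by rewrite mul0r /xlnx_poly; lra.
rewrite -subr_ge0.
(* xlnx_poly (t - 1) = t * W.[t] - 1 / 5 *)
pose u : {poly R} := 'X - 1.
pose W : {poly R} := (-1 / 20) *: u ^+ 4 + (2 / 15) *: u ^+ 3 - (3 / 10) *: u ^+ 2
  + (4 / 5) *: u + (1 / 5)%:P.
pose F : R -> R := (@ln R + horner (- W)) + 5^-1 \*: (fun y => y^-1).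
have FE x : F x = ln x + (- W).[x] + 5^-1 * x^-1 by [].
have -> : t * ln t - xlnx_poly (t - 1) = t * F t.
  by rewrite FE /W /u !hornerE /= /xlnx_poly; field; rewrite gt_eqF.
apply: mulr_ge0; first exact: ltW.
apply: (@ge0_of_derive_sign _ (fun x => (x - 1) ^+ 5 / (5 * x ^+ 2))) t0 => [x x0|x x0|].
- have x1 : x != 0 by rewrite gt_eqF.
  apply: is_derive_eq.
    exact: (is_deriveD (is_deriveD (is_derive1_ln x0) (is_derive_poly (- W) x))
      (is_deriveZ 5^-1 (is_derive_inv x1))).
  rewrite /W /u !derivCE !hornerE /= /GRing.scale /=; field; exact: x1.
- rewrite mulrA -exprS divr_ge0 //; first exact: exprn_even_ge0.
  by rewrite mulr_ge0 // exprn_ge0 // ltW.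
by rewrite FE ln1 /W /u !hornerE /=; field.
Qed.

(** As t = 1 + (t - 1), the right-hand side is t times the Taylor polynomial Q of
    degree 5 of ln at 1, and Q - ln has derivative (t - 1) ^ 5 / t. *)
Lemma xlnx_le (t : R) : 0 <= t -> t * ln t <= xlnx_poly (t - 1) + (t - 1) ^+ 6 / 5.
Proof.
rewrite le_eqVlt => /orP[/eqP <-|t0]; first by rewrite mul0r /xlnx_poly; lra.
rewrite -subr_ge0.
pose u : {poly R} := 'X - 1.
pose Q : {poly R} := u - (1 / 2) *: u ^+ 2 + (1 / 3) *: u ^+ 3 - (1 / 4) *: u ^+ 4
  + (1 / 5) *: u ^+ 5.
pose F : R -> R := horner Q - @ln R.
have FE x : F x = Q.[x] - ln x by [].
have -> : xlnx_poly (t - 1) + (t - 1) ^+ 6 / 5 - t * ln t = t * F t.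
  by rewrite FE /Q /u !hornerE /= /xlnx_poly; field.
apply: mulr_ge0; first exact: ltW.
apply: (@ge0_of_derive_sign _ (fun x => (x - 1) ^+ 5 / x)) t0 => [x x0|x x0|].
- have x1 : x != 0 by rewrite gt_eqF.
  apply: is_derive_eq.
    exact: (is_deriveB (is_derive_poly Q x) (is_derive1_ln x0)).
  rewrite /Q /u !derivCE !hornerE /=; field; exact: x1.
- by rewrite mulrA -exprS divr_ge0 ?(ltW x0) //; exact: exprn_even_ge0.
by rewrite FE ln1 /Q /u !hornerE /=; field.
Qed.

End XlnX.

(** * Central moments of binomial variables *)

Section CentralMoments.
Variables (R : realType) (mu : R).
Let v := mu * (1 - mu).

Definition central_moment n j :=
  binomial_expectation mu n (fun k => (k%:R - n%:R * mu) ^+ j).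

(** One more trial shifts N - n mu by - mu or by 1 - mu, independently. *)
Lemma central_momentS n j : central_moment n.+1 j =
  \sum_(i < j.+1) ((1 - mu) * (- mu) ^+ (j - i) + mu * (1 - mu) ^+ (j - i)) *
    central_moment n i *+ 'C(j, i).
Proof.
have shift (c : R) : binomial_expectation mu n (fun k => (c + (k%:R - n%:R * mu)) ^+ j) =
    \sum_(i < j.+1) c ^+ (j - i) * central_moment n i *+ 'C(j, i).
  under eq_fun do rewrite exprDn.
  rewrite binomial_expectation_sum; apply: eq_bigr => i _.
  rewrite -mulrnAl -binomial_expectationZ; congr binomial_expectation.
  by apply/funext => k; rewrite -mulrnAl.
rewrite /central_moment binomial_expectationS.
transitivity ((1 - mu) *
    binomial_expectation mu n (fun k => (- mu + (k%:R - n%:R * mu)) ^+ j) +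
  mu * binomial_expectation mu n (fun k => ((1 - mu) + (k%:R - n%:R * mu)) ^+ j)).
  congr (_ * _ + _ * _); congr binomial_expectation; apply/funext => k;
    congr (_ ^+ _); rewrite -natr1 -?[k.+1%:R]natr1; ring.
rewrite !shift !mulr_sumr -big_split /=; apply: eq_bigr => i _.
by rewrite !mulrnAr -mulrnDl !mulrA -mulrDl.
Qed.

(** The moments of orders 5 and 6 have size n ^ 2 and n ^ 3, hence contribute
    O(n ^ -3) to the expectation of a polynomial in N / n - mu. *)
Lemma central_momentE n :
  [/\ central_moment n 0 = 1,
      central_moment n 1 = 0,
      central_moment n 2 = n%:R * v,
      central_moment n 3 = n%:R * v * (1 - 2 * mu) &
  [/\ central_moment n 4 = n%:R * v * (1 - 6 * v) + 3 * (n%:R * v) ^+ 2,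
      central_moment n 5 = n%:R * v * (1 - 2 * mu) * (1 + 2 * v * (5 * n%:R - 6)) &
      central_moment n 6 = n%:R * v * (1 - 30 * v * (1 - 4 * v) +
         5 * n%:R * v * (5 - 26 * v) + 15 * (n%:R * v) ^+ 2)]].
Proof.
rewrite /v; elim: n => [|n [M0 M1 M2 M3 [M4 M5 M6]]].
  by split; [..|split]; rewrite /central_moment /=; ring.
pose c k := (1 - mu) * (- mu) ^+ k + mu * (1 - mu) ^+ k.
have step j : central_moment n.+1 j =
    \sum_(i < j.+1) c (j - i)%N * central_moment n i *+ 'C(j, i).
  exact: central_momentS.
have M1S : central_moment n.+1 1 =
    c 1%N * central_moment n 0 *+ 1 + c 0%N * central_moment n 1 *+ 1.
  by rewrite step !big_ord_recr big_ord0 /= add0r.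
have M2S : central_moment n.+1 2 =
    c 2%N * central_moment n 0 *+ 1 + c 1%N * central_moment n 1 *+ 2 +
    c 0%N * central_moment n 2 *+ 1.
  by rewrite step !big_ord_recr big_ord0 /= add0r.
have M3S : central_moment n.+1 3 =
    c 3%N * central_moment n 0 *+ 1 + c 2%N * central_moment n 1 *+ 3 +
    c 1%N * central_moment n 2 *+ 3 + c 0%N * central_moment n 3 *+ 1.
  by rewrite step !big_ord_recr big_ord0 /= add0r.
have M4S : central_moment n.+1 4 =
    c 4%N * central_moment n 0 *+ 1 + c 3%N * central_moment n 1 *+ 4 +
    c 2%N * central_moment n 2 *+ 6 + c 1%N * central_moment n 3 *+ 4 +
    c 0%N * central_moment n 4 *+ 1.
  by rewrite step !big_ord_recr big_ord0 /= add0r.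
have M5S : central_moment n.+1 5 =
    c 5%N * central_moment n 0 *+ 1 + c 4%N * central_moment n 1 *+ 5 +
    c 3%N * central_moment n 2 *+ 10 + c 2%N * central_moment n 3 *+ 10 +
    c 1%N * central_moment n 4 *+ 5 + c 0%N * central_moment n 5 *+ 1.
  by rewrite step !big_ord_recr big_ord0 /= add0r.
have M6S : central_moment n.+1 6 =
    c 6%N * central_moment n 0 *+ 1 + c 5%N * central_moment n 1 *+ 6 +
    c 4%N * central_moment n 2 *+ 15 + c 3%N * central_moment n 3 *+ 20 +
    c 2%N * central_moment n 4 *+ 15 + c 1%N * central_moment n 5 *+ 6 +
    c 0%N * central_moment n 6 *+ 1.
  by rewrite step !big_ord_recr big_ord0 /= add0r.
have M0S : central_moment n.+1 0 = 1 by rewrite /central_moment binomial_expectation_cst.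
rewrite M0S M1S M2S M3S M4S M5S M6S M0 M1 M2 M3 M4 M5 M6 /c -natr1.
by split; [..|split]; ring.
Qed.
End CentralMoments.

(** * Two expansions of binomial expectations *)

Section BinomialRisks.
Variables (R : realType) (mu : R).
Hypothesis mu01 : 0 < mu <= 1.
Let mu_gt0 : 0 < mu. Proof. by case/andP: mu01. Qed.
Let mu_ne0 : mu != 0. Proof. by rewrite gt_eqF. Qed.
Let mu01w : 0 <= mu <= 1. Proof. by case/andP: mu01 => /ltW -> ->. Qed.

(** The contribution of one category (or group) of probability mu to the risk of
    the observed frequencies. In terms of u = N / (n mu) - 1 the integrand is
    mu (1 + u) ln (1 + u), and the moments of orders 2, 3 and 4 of u produce the
    two displayed terms. *)
Lemma binomial_xlnx_risk : negligible (fun n =>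
  binomial_expectation mu n (fun k => k%:R / n%:R * ln (k%:R / n%:R / mu)) -
  ((1 - mu) / (2 * n%:R) + (12 * n%:R ^+ 2)^-1 * (mu^-1 - mu))).
Proof.
pose v := mu * (1 - mu).
(* c0, c1 collect what the polynomial of degree 5 leaves beyond order n ^ -2;
   d0, d1, d2 come from mu u ^ 6 / 5. *)
pose c0 := v * (1 - 6 * v) / (12 * mu ^+ 3) - v ^+ 2 * (1 - 2 * mu) / (2 * mu ^+ 4).
pose c1 := - (v * (1 - 2 * mu) * (1 - 12 * v) / (20 * mu ^+ 4)).
pose d0 := 3 * v ^+ 3 / mu ^+ 5.
pose d1 := v ^+ 2 * (5 - 26 * v) / mu ^+ 5.
pose d2 := v * (1 - 30 * v * (1 - 4 * v)) / (5 * mu ^+ 5).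
apply: (@negligible_cubic _ (`|c0| + `|c1| + (`|d0| + `|d1| + `|d2|))) => n.
set N : R := n.+1%:R; set main := (1 - mu) / _ + _; set L := binomial_expectation _ _ _.
have N0 : 0 < N by rewrite ltr0n.
have Nn1 : 1 + n%:R != 0 :> R by rewrite nat1r.
pose a := (N * mu)^-1.
pose u k : R := a * (k%:R - N * mu).
have tE k : k%:R / N / mu - 1 = u k.
  by rewrite /u /a; field; rewrite mu_ne0 Nn1.
have t0 k : 0 <= k%:R / N / mu by rewrite !divr_ge0 ?(ltW N0) ?(ltW mu_gt0).
have fE k : k%:R / N * ln (k%:R / N / mu) = mu * (k%:R / N / mu * ln (k%:R / N / mu)).
  by rewrite [RHS]mulrA [mu * _]mulrCA mulfV // mulr1.
have [_ M1 M2 M3 [M4 M5 M6]] := central_momentE mu n.+1.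
have momE j (b : R) : binomial_expectation mu n.+1 (fun k => b * u k ^+ j) =
    b * a ^+ j * central_moment mu n.+1 j.
  rewrite -binomial_expectationZ; congr binomial_expectation; apply/funext => k.
  by rewrite /u exprMn mulrA.
pose low := mu * (a * central_moment mu n.+1 1 + a ^+ 2 * central_moment mu n.+1 2 / 2
  - a ^+ 3 * central_moment mu n.+1 3 / 6 + a ^+ 4 * central_moment mu n.+1 4 / 12
  - a ^+ 5 * central_moment mu n.+1 5 / 20).
pose up := low + mu * (a ^+ 6 * central_moment mu n.+1 6 / 5).
have lowE : binomial_expectation mu n.+1 (fun k => mu * xlnx_poly (u k)) = low.
  transitivity (binomial_expectation mu n.+1 (fun k => mu * u k ^+ 1 + (mu / 2 * u k ^+ 2
    + (- (mu / 6) * u k ^+ 3 + (mu / 12 * u k ^+ 4 + - (mu / 20) * u k ^+ 5))))).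
    by congr binomial_expectation; apply/funext => k; rewrite /xlnx_poly; ring.
  by rewrite !binomial_expectationD !momE /low; ring.
have upE : up =
    binomial_expectation mu n.+1 (fun k => mu * (xlnx_poly (u k) + u k ^+ 6 / 5)).
  rewrite /up -lowE.
  transitivity (binomial_expectation mu n.+1
      (fun k => mu * xlnx_poly (u k) + mu / 5 * u k ^+ 6)).
    by rewrite binomial_expectationD momE; congr (_ + _); ring.
  by congr binomial_expectation; apply/funext => k; ring.
have lowL : low <= L.
  rewrite -lowE; apply: le_binomial_expectation => // k.
  by rewrite fE ler_pM2l // -tE; exact: xlnx_ge.
have Lup : L <= up.
  rewrite upE; apply: le_binomial_expectation => // k.
  by rewrite fE ler_pM2l // -tE; exact: xlnx_le.
have lowC : low = main + (c0 + c1 / N) / N ^+ 3.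
  rewrite /low M1 M2 M3 M4 M5 /main /c0 /c1 /a /v -/N.
  by field; rewrite mu_ne0 Nn1.
have upC : up = low + (d0 + d1 / N + d2 / N ^+ 2) / N ^+ 3.
  rewrite /up M6 /d0 /d1 /d2 /a /v -/N; congr (_ + _).
  by field; rewrite mu_ne0 Nn1.
have Nle j : N ^- j <= 1 by rewrite invf_le1 ?exprn_gt0 // exprn_ege1 // ler1n.
have b1 (c : R) j : `|c / N ^+ j| <= `|c|.
  by rewrite normrM [X in _ * X]ger0_norm ?invr_ge0 ?exprn_ge0 ?(ltW N0) // ler_piMr.
clearbody c0 c1 d0 d1 d2 low main L.
have H1 := b1 c1 1%N; have H2 := b1 d1 1%N; have H3 := b1 d2 2%N.
rewrite !expr1 in H1 H2.
have Ni : 0 < N ^- 3 by rewrite invr_gt0 exprn_gt0.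
have bc : `|c0 + c1 / N| <= `|c0| + `|c1| by apply: le_trans (ler_normD _ _) _; rewrite lerD2l.
have bd : `|d0 + d1 / N + d2 / N ^+ 2| <= `|d0| + `|d1| + `|d2|.
  by apply: le_trans (ler_normD _ _) (lerD _ H3); apply: le_trans (ler_normD _ _) (lerD _ H2).
rewrite upC lowC in Lup; rewrite lowC in lowL.
have sandwich (x y : R) : main + x <= L -> L <= main + x + y -> `|L - main| <= `|x| + `|y|.
  have := ler_norm x; have := ler_norm y; have := ler_norm (- x); have := normr_ge0 y.
  by rewrite normrN ler_norml; lra.
apply: le_trans (sandwich _ _ lowL Lup) _; rewrite [leRHS]mulrDl.
by apply: lerD; rewrite normrM (gtr0_norm Ni) ler_pM2r.
Qed.
(** A risk g observed at the random sample size N and weighted by N / n: by size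
    bias it is mu E[g (N' + 1)], N' binomial of size n - 1, where inverse moments
    take over. The factor N / n is responsible for the single power of mu in the
    second-order term, and for its absence from the first-order one. *)
Lemma binomial_weighted_risk (g : nat -> R) (a b : R) :
    negligible (fun n => g n - (a / n%:R + b / n%:R ^+ 2)) ->
  negligible (fun n => binomial_expectation mu n (fun k => k%:R / n%:R * g k) -
    (a / n%:R + b / mu / n%:R ^+ 2)).
Proof.
set d := (fun n => g n - _) => nd.
(* The errors of the a-term, of the b-term and of the remainder of g. *)
pose e1 n := - (a * (1 - mu) ^+ n / n%:R).
pose e2 n := mu * b *
  (binomial_expectation mu n.-1 (fun k => k.+1%:R ^- 2) - (mu * n%:R) ^- 2).
pose e3 n := mu * binomial_expectation mu n.-1 (fun k => d k.+1).
have ne1 : negligible e1.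
  have [C C0 qC] := binomial_eq0_bound mu01.
  apply: (@negligible_cubic _ (`|a| * C)) => n.
  have q0 : 0 <= (1 - mu) ^+ n.+1 by rewrite exprn_ge0 // subr_ge0; case/andP: mu01.
  have N1 : n.+1%:R^-1 <= 1 :> R by rewrite invf_le1 ?ler1n.
  rewrite normrN -mulrA normrM -mulrA ler_wpM2l // ger0_norm ?divr_ge0 //.
  apply: (@le_trans _ _ ((1 - mu) ^+ n.+1)); first by rewrite ler_piMr.
  apply: le_trans (qC _) _; rewrite ler_pM2l // lef_pV2 ?posrE ?exprn_gt0 //.
  by rewrite lerXn2r ?nnegrE // ler_nat.
have ne2 : negligible e2.
  have [C qC] := inverse_moment2 mu01.
  apply: (@negligible_cubic _ (`|mu * b| * C)) => n.
  by rewrite normrM -mulrA ler_wpM2l.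
have ne3 : negligible e3.
  have [C2 C20 C2n] := inverse_moment_bound mu01 2.
  have [C3 C30 C3n] := inverse_moment_bound mu01 3.
  move=> eps eps0; have [|C dC] := nd (eps / (mu * C2)); first by rewrite divr_gt0 ?mulr_gt0.
  exists (mu * (`|C| * C3)) => n; rewrite /e3 normrM (gtr0_norm mu_gt0) /=.
  have -> : eps / n.+1%:R ^+ 2 + mu * (`|C| * C3) / n.+1%:R ^+ 3 =
      mu * (eps / (mu * C2) * (C2 / n.+1%:R ^+ 2) + `|C| * (C3 / n.+1%:R ^+ 3)).
    by field; rewrite mu_ne0 (gt_eqF C20) nat1r pnatr_eq0.
  rewrite ler_pM2l //; apply: le_trans (binomial_expectation_norm_le mu01w _ _) _.
  have e0 : 0 <= eps / (mu * C2) by rewrite divr_ge0 ?mulr_ge0 // ltW.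
  apply: le_trans (lerD (ler_wpM2l e0 (C2n n)) (ler_wpM2l (normr_ge0 C) (C3n n))).
  rewrite -!binomial_expectationZ -binomial_expectationD.
  apply: le_binomial_expectation => // k; apply: le_trans (dC k) _; rewrite lerD2l.
  by rewrite ler_wpM2r ?invr_ge0 ?exprn_ge0 // ler_norm.
apply: eq_negligible (negligibleD ne1 (negligibleD ne2 ne3)) => n.
rewrite /e1 /e2 /e3 succnK.
have -> : binomial_expectation mu n.+1 (fun k => k%:R / n.+1%:R * g k) =
    mu * binomial_expectation mu n (fun k => g k.+1).
  transitivity (n.+1%:R^-1 * binomial_expectation mu n.+1 (fun k => k%:R * g k)).
    by rewrite -binomial_expectationZ; congr binomial_expectation; apply/funext => k; ring.
  by rewrite binomial_expectation_size_bias // mulrA mulKf.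
have -> : (fun k => g k.+1) = (fun k => a * k.+1%:R^-1 + (b * k.+1%:R ^- 2 + d k.+1)).
  by apply/funext => k; rewrite /d; ring.
rewrite !binomial_expectationD !binomial_expectationZ inverse_moment1 //.
move: (binomial_expectation _ _ _) (binomial_expectation _ _ _) => x y.
by field; rewrite mu_ne0 nat1r pnatr_eq0.
Qed.

End BinomialRisks.

(** * Maximum likelihood in the full model *)

Section FullModel.
Variables (R : realType) (k : nat).
Implicit Types (q : 'rV[R]_k) (x : 'I_k -> nat).

Lemma closure_open_simplex q : closure (@open_simplex R k) q ->
  (forall j, 0 <= q ord0 j) /\ \sum_j q ord0 j = 1.
Proof.
have closed_fun (f : 'rV[R]_k -> R) (D : set R) : continuous f -> closed D ->
    @open_simplex R k `<=` f @^-1` D -> closure (@open_simplex R k) q -> D (f q).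
  move=> cf cD sD /(closureS sD); rewrite -(closure_id _).1 //.
  by apply: preimage_closed => // y _; exact: cf.
move=> qM; split=> [j|].
  apply: (closed_fun (fun q => q ord0 j) [set y | 0 <= y]) qM.
  - exact: coord_continuous.
  - exact: closed_ge.
  - by move=> y [y0 _]; exact: ltW.
apply: (closed_fun (fun q => \sum_j q ord0 j) [set y | y = 1]) qM.
- by apply: continuous_big => [|j _]; [exact: add_continuous | exact: coord_continuous].
- exact: closed_eq.
- by move=> y [].
Qed.

Definition empirical x : 'rV[R]_k := \row_j ((x j)%:R / (\sum_j x j)%:R).

Lemma empirical_sum1 x : (0 < \sum_j x j)%N -> \sum_j empirical x ord0 j = 1.
Proof.
move=> x0; under eq_bigr do rewrite mxE.
by rewrite -mulr_suml -natr_sum divff // pnatr_eq0 -lt0n.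
Qed.

(** Mixing with the uniform distribution makes all frequencies positive. *)
Lemma closure_empirical x : (0 < \sum_j x j)%N -> closure (@open_simplex R k) (empirical x).
Proof.
move=> x0.
have k0 : (0 < k)%N by case: (k) x x0 => // x; rewrite big_ord0.
have kR : 0 < k%:R :> R by rewrite ltr0n.
pose unif : 'rV[R]_k := \row_j k%:R^-1.
pose mix (t : R) := empirical x + t *: (unif - empirical x).
have mix_cvg : mix t @[t --> 0^'+] --> empirical x.
  have -> : empirical x = mix 0 by rewrite /mix scale0r addr0.
  apply: cvgD; first exact: cvg_cst.
  by apply: cvgZr_tmp; apply: cvg_at_right_filter; exact: cvg_id.
move=> B /mix_cvg /= mixB; near (0 : R)^'+ => t; exists (mix t); split; last by near: t.
have t0 : 0 < t by near: t; exact: nbhs_right_gt.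
have t1 : t < 1 by near: t; exact: nbhs_right_lt.
have mixE j : mix t ord0 j = (1 - t) * empirical x ord0 j + t * k%:R^-1.
  by rewrite /mix !mxE; ring.
split=> [j|].
  rewrite mixE ltr_wpDl //; first by rewrite mulr_ge0 ?subr_ge0 ?mxE ?divr_ge0 // ltW.
  by rewrite mulr_gt0 ?invr_gt0.
under eq_bigr do rewrite mixE.
rewrite big_split /= -!mulr_sumr empirical_sum1 // sumr_const card_ord.
by rewrite -[k%:R^-1 *+ k]mulr_natr mulVf ?gt_eqF // !mulr1 subrK.
Unshelve. all: by end_near. Qed.

(** The factor by which q changes the likelihood at the empirical frequencies is
    at most expR (\sum_j x j * (q j / e j - 1)) <= 1, and 1 + y < expR y makes
    it smaller than 1 as soon as q differs from e at an observed category. *)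
Lemma mle_full_model x q : (0 < \sum_j x j)%N -> is_mle (@open_simplex R k) x q ->
  q = empirical x.
Proof.
move=> x0 [qM qmax]; have [q0 q1] := closure_open_simplex qM.
have {qmax} := qmax _ (closure_empirical x0).
set e := empirical x; pose N : R := (\sum_j x j)%:R.
have N0 : 0 < N by rewrite ltr0n.
have eE j : e ord0 j = (x j)%:R / N by rewrite mxE.
have e1 : \sum_j e ord0 j = 1 by exact: empirical_sum1.
have e_gt0 j : (0 < x j)%N -> 0 < e ord0 j by move=> xj; rewrite eE divr_gt0 // ltr0n.
(* For an unobserved j, e j = 0 and t j = 0: such a j contributes the factor 1. *)
pose t j := q ord0 j / e ord0 j.
have t0 j : 0 <= t j by rewrite divr_ge0 // eE divr_ge0 // ltW.
have prodE : \prod_j q ord0 j ^+ x j = \prod_j e ord0 j ^+ x j * \prod_j t j ^+ x j.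
  rewrite -big_split; apply: eq_bigr => j _ /=; case: (posnP (x j)) => [->|xj].
    by rewrite !expr0 mulr1.
  by rewrite -exprMn mulrCA divff ?mulr1 // gt_eqF // e_gt0.
have pe : 0 < \prod_j e ord0 j ^+ x j.
  by apply: prodr_gt0 => j _; case: (posnP (x j)) => [->|xj]; rewrite ?expr0 ?exprn_gt0 ?e_gt0.
have fact0 : 0 < (\sum_j x j)`!%:R / (\prod_j (x j)`!)%:R :> R.
  by rewrite divr_gt0 ?ltr0n ?fact_gt0 ?prodn_gt0 // => j; rewrite fact_gt0.
rewrite /multinomial_pmf prodE ler_pM2l // -[X in X <= _]mulr1 ler_pM2l // => prod_ge1.
have le_exp j : 0 <= t j ^+ x j <= expR ((x j)%:R * (t j - 1)).
  rewrite exprn_ge0 //= expRM_natl lerXn2r ?nnegrE ?expR_ge0 //.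
  by have := expR_ge1Dx (t j - 1); rewrite addrC subrK.
have sum_le0 : \sum_j (x j)%:R * (t j - 1) <= 0.
  apply: (@le_trans _ _ (\sum_j (N * q ord0 j - (x j)%:R))).
    apply: ler_sum => j _; rewrite mulrBr mulr1 lerD2r /t.
    case: (posnP (x j)) => [->|xj]; first by rewrite mul0r mulr_ge0 ?(ltW N0).
    have xj0 : (x j)%:R != 0 :> R by rewrite pnatr_eq0 -lt0n.
    by rewrite le_eqVlt; apply/orP; left; apply/eqP; rewrite eE; field; rewrite xj0 gt_eqF.
  by rewrite sumrB -mulr_sumr q1 mulr1 -natr_sum subrr.
have te j : (0 < x j)%N -> t j = 1.
  move=> xj; apply/eqP/negPn/negP => tj; move: prod_ge1; apply/negP; rewrite -ltNge.
  have ltj : t j ^+ x j < expR ((x j)%:R * (t j - 1)).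
    rewrite expRM_natl ltrXn2r ?nnegrE ?expR_ge0 -?lt0n //.
    have := @expR_gt1Dx R (t j - 1); rewrite subr_eq0 => /(_ tj).
    by rewrite addrC subrK.
  apply: (@lt_le_trans _ _ (expR (\sum_j (x j)%:R * (t j - 1)))); last first.
    by rewrite -[leRHS]expR0 ler_expR.
  rewrite expR_sum (bigD1 j) //= [ltRHS](bigD1 j) //=.
  apply: (@le_lt_trans _ _ (t j ^+ x j * \prod_(i < k | i != j) expR ((x i)%:R * (t i - 1)))).
    by rewrite ler_wpM2l ?exprn_ge0 // ler_prod.
  by rewrite ltr_pM2r // prodr_gt0 // => i _; exact: expR_gt0.
have qe j : (0 < x j)%N -> q ord0 j = e ord0 j.
  by move=> xj; have := te _ xj; rewrite /t => /divr1_eq.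
have le_eq j : e ord0 j <= q ord0 j ?= iff (e ord0 j == q ord0 j).
  split=> //; case: (posnP (x j)) => [xj|/qe ->//].
  by rewrite eE xj mul0r.
have := leif_sum (fun j (_ : true) => le_eq j); rewrite e1 q1 => -[_].
rewrite eqxx => /esym/forallP eq; apply/rowP => j.
by have /implyP/(_ isT)/eqP := eq j; rewrite -[j in LHS]/j ord1.
Qed.

End FullModel.

(** * Divergence bounds and conditioning *)

(** The point is that q ln q stays in the interval from -1 to 0. *)
Lemma kl_div_norm_le (R : realType) (T : finType) (q r : T -> R) :
    (forall t, 0 <= q t <= 1) -> (forall t, 0 < r t) ->
  `|kl_div q r| <= \sum_t (1 + `|ln (r t)|).
Proof.
move=> q01 r0; apply: le_trans (ler_norm_sum _ _ _) _; apply: ler_sum => t _.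
have /andP[] := q01 t; rewrite le_eqVlt => /orP[/eqP <- _|qt0 qt1].
  by rewrite mul0r normr0 addr_ge0.
rewrite ln_div ?posrE // mulrBr; apply: le_trans (ler_normB _ _) (lerD _ _).
  rewrite ler_norml; have := ln_le0 qt1 => lq.
  have : q t * ln (q t) <= 0 by rewrite mulr_ge0_le0 // ltW.
  suff : -1 <= q t * ln (q t) by lra.
  have H : ln (q t)^-1 <= (q t)^-1 - 1.
    by rewrite -{1}[(q t)^-1](subrK 1) addrC le_ln1Dx // ltrBrDr addNr invr_gt0.
  have := ler_wpM2l (ltW qt0) H; rewrite lnV ?posrE // mulrN mulrBr divff ?gt_eqF // mulr1.
  lra.
by rewrite normrM (gtr0_norm qt0) ler_piMl.
Qed.

Lemma kl_div_scale (R : realType) (k : nat) (q p : 'I_k -> R) (a b : R) :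
    0 < a -> 0 < b -> (forall j, 0 <= q j) -> \sum_j q j = 1 -> (forall j, 0 < p j) ->
  kl_div (fun j => a * q j) (fun j => b * p j) = a * ln (a / b) + a * kl_div q p.
Proof.
move=> a0 b0 q0 q1 p0.
have -> : a * ln (a / b) = \sum_j a * ln (a / b) * q j by rewrite -mulr_sumr q1 mulr1.
rewrite [a * kl_div _ _]mulr_sumr -big_split /=.
apply: eq_bigr => j _; have := q0 j; rewrite le_eqVlt => /orP[/eqP <-|qj0].
  by rewrite !(mulr0, mul0r) addr0.
have -> : a * q j / (b * p j) = (a / b) * (q j / p j).
  by field; rewrite !gt_eqF.
by rewrite lnM ?posrE ?divr_gt0 //; ring.
Qed.

(** Conditioning on an event of probability 1 - O(n ^- 3) does not change the
    expectation of bounded variables at order n ^- 2. *)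
Lemma negligible_conditioning (R : realType) (T : finType) (q : T -> R)
    (A : pred (T -> nat)) (f : nat -> (T -> nat) -> R) (C C' : R) :
    (forall t, 0 <= q t) -> \sum_t q t = 1 ->
    (forall n x, (\sum_t x t)%N = n -> `|f n x| <= C) ->
    (forall n, multinomial_expectation q n.+1 (fun x => (~~ A x)%:R) <= C' / n.+1%:R ^+ 3) ->
  negligible (fun n => multinomial_cond_expectation q n A (f n) -
    multinomial_expectation q n (f n)).
Proof.
move=> q0 q1 fC eC.
have C0 : 0 <= C by apply: le_trans (normr_ge0 _) (fC _ (fun=> 0%N) erefl).
apply: (@negligible_cubic _ (4 * C * C')) => n.
rewrite -[leRHS]mulrA; apply: le_trans (ler_wpM2l _ (eC n)); last by rewrite mulr_ge0.
rewrite /multinomial_cond_expectation; move: (n.+1) => {}n.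
set e := multinomial_expectation q n (fun x => (~~ A x)%:R).
set P := multinomial_expectation q n (fun x => (A x)%:R).
set EA := multinomial_expectation q n (fun x => (A x)%:R * f n x).
set E := multinomial_expectation q n (f n).
pose EB := multinomial_expectation q n (fun x => (~~ A x)%:R * f n x).
have absle B g : (forall x, (\sum_t x t)%N = n -> `|g x| <= C) ->
    `|multinomial_expectation q n (fun x => (B x : bool)%:R * g x)| <=
    C * multinomial_expectation q n (fun x => (B x)%:R).
  move=> gC; rewrite -multinomial_expectationZ ler_norml; apply/andP; split.
    rewrite -mulN1r -multinomial_expectationZ; apply: le_multinomial_expectation => // x /gC.
    by rewrite ler_norml => /andP[H _]; case: (B x); rewrite /= ?mulr1n ?mulr0n; lra.
  apply: le_multinomial_expectation => // x /gC.
  by rewrite ler_norml => /andP[_ H]; case: (B x); rewrite /= ?mulr1n ?mulr0n; lra.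
have EAC : `|EA| <= C * P by apply: absle => x; exact: fC.
have EBC : `|EB| <= C * e by apply: absle => x; exact: fC.
have EC : `|E| <= C by apply: multinomial_expectation_norm_le => // x; exact: fC.
have Ee : E = EA + EB.
  rewrite -multinomial_expectationD; apply: eq_multinomial_expectation => x _.
  by case: (A x) => /=; ring.
have Pe : P + e = 1.
  rewrite -multinomial_expectationD -[RHS](multinomial_expectation_cst n 1 q1).
  by apply: eq_multinomial_expectation => x _; case: (A x); rewrite ?addr0 ?add0r.
have P0 : 0 <= P.
  rewrite -(multinomial_expectation_cst n 0 q1).
  by apply: le_multinomial_expectation.
have e0 : 0 <= e.
  rewrite -(multinomial_expectation_cst n 0 q1).
  by apply: le_multinomial_expectation.
clearbody e P EA E EB.
have ratio : `|EA / P| <= C.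
  move: P0; rewrite le_eqVlt => /orP[/eqP <-|P0]; first by rewrite invr0 mulr0 normr0.
  by rewrite normrM normfV (gtr0_norm P0) ler_pdivrMr.
(* When A^c is likely, the trivial bound 2 C is already at most 4 C e. *)
have [e2|e2] := leP (1 / 2) e.
  apply: le_trans (ler_normB _ _) _; apply: le_trans (lerD ratio EC) _.
  have : 0 <= C * (e - 1 / 2) by rewrite mulr_ge0 ?subr_ge0.
  by lra.
have P2 : 1 / 2 < P by lra.
have P_gt0 : 0 < P by lra.
have -> : EA / P - E = (E * e - EB) / P.
  have -> : EA = E - EB by rewrite Ee addrK.
  have -> : e = 1 - P by rewrite -Pe addrAC subrr add0r.
  by field; rewrite gt_eqF.
rewrite normrM normfV (gtr0_norm P_gt0) ler_pdivrMr //.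
apply: le_trans (ler_normB _ _) _; rewrite normrM.
rewrite (ger0_norm e0).
have : `|E| * e <= C * e by rewrite ler_wpM2r.
have : 0 <= C * e * (P - 1 / 2) by rewrite !mulr_ge0 // subr_ge0 ltW.
by lra.
Qed.

(** * The two-stage risk *)

Section TwoStageRisk.
Variables (R : realType) (r : nat) (J : 'I_r -> nat) (m : category J -> R).
Hypothesis J_gt0 : forall i, (0 < J i)%N.
Hypothesis m_gt0 : forall c, 0 < m c.
Hypothesis m_sum1 : \sum_c m c = 1.

Lemma cell_inj i : injective (@cell r J i).
Proof.
by move=> j k /eqP; rewrite -tag_eqE /tag_eq /= eqxx /= tagged_asE => /eqP.
Qed.

Lemma sum_cells (V : nmodType) (F : category J -> V) :
  \sum_c F c = \sum_i \sum_(j < J i) F (cell j).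
Proof. by rewrite sig_big_dep; apply: eq_bigr => -[i j]. Qed.

Lemma marginal_gt0 i : 0 < marginal m i.
Proof.
rewrite /marginal (bigD1 (Ordinal (J_gt0 i))) //= ltr_pwDl //.
by apply: sumr_ge0 => j _; exact: ltW.
Qed.

Lemma marginal_sum1 : \sum_i marginal m i = 1.
Proof. by rewrite -m_sum1 sum_cells. Qed.

Lemma marginal_le1 i : marginal m i <= 1.
Proof.
rewrite -marginal_sum1 (bigD1 i) //= lerDl.
by apply: sumr_ge0 => k _; exact/ltW/marginal_gt0.
Qed.

Lemma marginal01 i : 0 < marginal m i <= 1.
Proof. by rewrite marginal_gt0 marginal_le1. Qed.

Lemma conditional_gt0 i j : 0 < conditional m i ord0 j.
Proof. by rewrite mxE divr_gt0 // marginal_gt0. Qed.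

Lemma conditional_sum1 i : \sum_j conditional m i ord0 j = 1.
Proof.
under eq_bigr do rewrite mxE.
by rewrite -mulr_suml divff // gt_eqF // marginal_gt0.
Qed.

Lemma expectation_subcounts i n (f : ('I_(J i) -> nat) -> R) :
  multinomial_expectation m n (fun x => f (subcounts x (i := i))) =
  binomial_expectation (marginal m i) n
    (fun k => multinomial_expectation (conditional m i ord0) k f).
Proof.
have -> : (conditional m i ord0 : 'I_(J i) -> R) = (fun j => m (cell j) / marginal m i).
  by apply/funext => j; rewrite mxE.
apply: (multinomial_expectation_block n f (@cell_inj i) m_sum1).
by rewrite gt_eqF // marginal_gt0.
Qed.

Lemma expectation_group_count i n (g : nat -> R) :
  multinomial_expectation m n (fun x => g (group_count x i)) =
  binomial_expectation (marginal m i) n g.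
Proof.
rewrite (@expectation_subcounts i n (fun y => g (\sum_j y j)%N)).
congr binomial_expectation; apply/funext => k.
rewrite -[RHS](multinomial_expectation_cst k (g k) (conditional_sum1 i)).
by apply: eq_multinomial_expectation => y ->.
Qed.

Lemma empty_group_bound : exists C : R, forall n,
  multinomial_expectation m n.+1 (fun x => (~~ no_empty_group x)%:R) <= C / n.+1%:R ^+ 3.
Proof.
have bound i := cid2 (binomial_eq0_bound (marginal01 i)).
exists (\sum_i sval (bound i)) => n.
apply: (@le_trans _ _ (\sum_i (1 - marginal m i) ^+ n.+1)); last first.
  rewrite mulr_suml; apply: ler_sum => i _; case: (bound i) => /= C _ Cn.
  have /andP[mi0 mi1] := marginal01 i.
  by apply: le_trans (Cn n); rewrite exprS ler_piMl ?exprn_ge0 ?subr_ge0 // gerBl ltW.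
apply: (@le_trans _ _ (multinomial_expectation m n.+1
    (fun x => \sum_i (group_count x i == 0%N)%:R))).
  apply: le_multinomial_expectation => [c|x _]; first exact: ltW.
  rewrite /no_empty_group negb_forall; case: existsP => [[i]|_]; last exact: sumr_ge0.
  rewrite negbK => xi; rewrite (bigD1 i) //= xi lerDl; exact: sumr_ge0.
rewrite multinomial_expectation_sum; apply: ler_sum => i _.
by rewrite (expectation_group_count i n.+1 (fun k => (k == 0%N)%:R)) binomial_expectation_eq0.
Qed.

Variable phat : forall i : 'I_r, ('I_(J i) -> nat) -> 'rV[R]_(J i).
Hypothesis phat_simplex : forall i (x : 'I_(J i) -> nat), (0 < \sum_j x j)%N ->
  (forall j, 0 <= phat x ord0 j) /\ \sum_j phat x ord0 j = 1.

Lemma mhat_01 n x c : (\sum_c x c)%N = n -> 0 <= mhat phat n x c <= 1.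
Proof.
move=> sx; rewrite /mhat; case: (posnP (group_count x (tag c))) => [->|x0].
  by rewrite !mul0r lexx ler01.
have [p0 p1] := phat_simplex x0.
have gn : (group_count x (tag c) <= n)%N.
  by rewrite -sx sum_cells (bigD1 (tag c)) //= leq_addr.
have n0 : 0 < n%:R :> R by rewrite ltr0n (leq_trans x0).
set a : R := (group_count x (tag c))%:R / n%:R.
have a0 : 0 <= a by rewrite divr_ge0.
have a1 : a <= 1 by rewrite ler_pdivrMr // mul1r ler_nat.
have b0 := p0 (tagged c).
have b1 : phat (subcounts x (i:=tag c)) ord0 (tagged c) <= 1.
  by rewrite -p1 (bigD1 (tagged c)) //= lerDl; apply: sumr_ge0.
by rewrite mulr_ge0 //= mulr_ile1.
Qed.

(** Chain rule: the divergence splits into a first-stage divergence and the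
    second-stage ones, weighted by the observed group frequencies; an empty group
    has weight 0, whatever the value of the estimator there. *)
Lemma kl_div_mhat n x : (0 < n)%N ->
  kl_div (mhat phat n x) m =
  \sum_i ((group_count x i)%:R / n%:R * ln ((group_count x i)%:R / n%:R / marginal m i) +
    (group_count x i)%:R / n%:R *
      kl_div (phat (subcounts x (i := i)) ord0) (conditional m i ord0)).
Proof.
move=> n0; rewrite /kl_div sum_cells; apply: eq_bigr => i _.
rewrite /mhat /=; case: (posnP (group_count x i)) => [->|x0].
  by rewrite !mul0r addr0 big1 // => j _; rewrite !mul0r.
have [p0 p1] := phat_simplex x0.
rewrite -kl_div_scale //; last exact: conditional_gt0.
- apply: eq_bigr => j _; rewrite mxE [marginal m i * _]mulrCA divff ?mulr1 //.
  by rewrite gt_eqF // marginal_gt0.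
- by rewrite divr_gt0 ?ltr0n.
- exact: marginal_gt0.
Qed.

Lemma expectation_kl_div_mhat n : (0 < n)%N ->
  multinomial_expectation m n (fun x => kl_div (mhat phat n x) m) =
  \sum_i (binomial_expectation (marginal m i) n
            (fun k => k%:R / n%:R * ln (k%:R / n%:R / marginal m i)) +
          binomial_expectation (marginal m i) n
            (fun k => k%:R / n%:R * stage_risk phat (conditional m i) k)).
Proof.
move=> n0.
under eq_multinomial_expectation => x _ do rewrite kl_div_mhat //.
rewrite multinomial_expectation_sum; apply: eq_bigr => i _.
rewrite multinomial_expectationD; congr (_ + _).
  exact: (expectation_group_count i n
    (fun k => k%:R / n%:R * ln (k%:R / n%:R / marginal m i))).
rewrite (@expectation_subcounts i n (fun y => (\sum_j y j)%N%:R / n%:R *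
  kl_div (phat y ord0) (conditional m i ord0))).
congr binomial_expectation; apply/funext => k.
rewrite -multinomial_expectationZ.
by apply: eq_multinomial_expectation => y ->.
Qed.

Lemma two_stage_risk_expansion (a b : 'I_r -> R) :
    (forall i, negligible (fun n =>
       stage_risk phat (conditional m i) n - (a i / n%:R + b i / n%:R ^+ 2))) ->
  negligible (fun n => two_stage_risk phat m n -
    \sum_i ((1 - marginal m i) / (2 * n%:R) +
            (12 * n%:R ^+ 2)^-1 * ((marginal m i)^-1 - marginal m i) +
            (a i / n%:R + b i / marginal m i / n%:R ^+ 2))).
Proof.
move=> stage.
have [C eC] := empty_group_bound.
have cond := @negligible_conditioning R _ m (@no_empty_group r J)
  (fun n x => kl_div (mhat phat n x) m) (\sum_c (1 + `|ln (m c)|)) C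
  (fun c => ltW (m_gt0 c)) m_sum1.
have {}cond := cond _ _.
have first i := binomial_xlnx_risk (marginal01 i).
have second i := binomial_weighted_risk (marginal01 i) (stage i).
have sum := negligible_sum (fun i => negligibleD (first i) (second i)).
apply: eq_negligible (negligibleD (cond _ _) sum) => [n|n x sx|n].
- rewrite -[RHS](subrKA (multinomial_expectation m n.+1
      (fun x => kl_div (mhat phat n.+1 x) m))); congr (_ + _).
  by rewrite expectation_kl_div_mhat // -sumrB; apply: eq_bigr => i _; ring.
- by apply: kl_div_norm_le => // c; exact: mhat_01.
exact: eC.
Qed.

End TwoStageRisk.

(** The divergence of the observed frequencies is a sum over categories, each
    count being binomial; the first- and second-order terms add up because the
    probabilities sum to 1. *)
Lemma full_model_risk (R : realType) (T : finType) (q : T -> R) :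
    (forall t, 0 < q t) -> \sum_t q t = 1 ->
  negligible (fun n =>
    multinomial_expectation q n (fun x => kl_div (fun t => (x t)%:R / n%:R) q) -
    ((#|T|%:R - 1) / (2 * n%:R) + (12 * n%:R ^+ 2)^-1 * (\sum_t (q t)^-1 - 1))).
Proof.
move=> q0 q1.
have q01 t : 0 < q t <= 1.
  by rewrite q0 -q1 (bigD1 t) //= lerDl; apply: sumr_ge0 => u _; exact: ltW.
have count1 t n (g : nat -> R) :
    multinomial_expectation q n (fun x => g (x t)) = binomial_expectation (q t) n g.
  have sum_unit : \sum_(s : unit) q t = q t by rewrite (big_pred1 tt) // => -[].
  have hI : injective (fun _ : unit => t) by move=> [] [].
  have qt0 : \sum_(s : unit) q t != 0 by rewrite sum_unit gt_eqF.
  rewrite (multinomial_expectation_block n (fun y : unit -> nat => g (y tt)) hI q1 qt0).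
  rewrite sum_unit; congr binomial_expectation; apply/funext => k.
  rewrite -[RHS](@multinomial_expectation_cst R unit (fun=> q t / q t) k (g k)); last first.
    by rewrite (big_pred1 tt) => [|[]] //; rewrite divff // gt_eqF.
  by apply: eq_multinomial_expectation => y; rewrite (big_pred1 tt) => [<-|[]].
apply: eq_negligible (negligible_sum (fun t => binomial_xlnx_risk (q01 t))) => n.
rewrite sumrB; congr (_ - _).
  rewrite multinomial_expectation_sum; apply: eq_bigr => t _.
  by rewrite (count1 t _ (fun k => k%:R / n.+1%:R * ln (k%:R / n.+1%:R / q t))).
by rewrite big_split /= -mulr_suml -mulr_sumr !sumrB q1 sumr_const.
Qed.

Theorem theorem1 (R : realType) (r : nat) (J : 'I_r -> nat)
    (J_gt0 : forall i, (0 < J i)%N)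
    (m : category J -> R)
    (m_gt0 : forall c, 0 < m c) (m_sum1 : \sum_c m c = 1)
    (s : 'I_r -> nat) (s_le : forall i, (s i <= (J i).-1)%N)
    (M : forall i, set 'rV[R]_(J i))
    (M_model : forall i, parametric_model (s i) (M i))
    (M_true : forall i, M i (conditional m i))
    (phat : forall i, ('I_(J i) -> nat) -> 'rV[R]_(J i))
    (phat_mle : forall i (x : 'I_(J i) -> nat),
        (0 < \sum_j x j)%N -> is_mle (M i) x (phat i x)) :
  (forall A : 'I_r -> R,
     (forall i, stage_risk phat (conditional m i) =
        (fun n : nat => (s i)%:R / (2 * n%:R) + (24 * n%:R ^+ 2)^-1 * A i)
        +o_\oo (fun n : nat => n%:R ^- 2 : R)) ->
     let p' : R := r%:R - 1 + \sum_i (s i)%:R in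
     let Mf : R := \sum_i (marginal m i)^-1 in
     two_stage_risk phat m =
       (fun n : nat => p' / (2 * n%:R) +
          (24 * n%:R ^+ 2)^-1 *
            (\sum_i (marginal m i)^-1 * (A i + 2) - 2))
       +o_\oo (fun n : nat => n%:R ^- 2 : R) /\
     two_stage_risk phat m =
       (fun n : nat => (2 * n%:R)^-1 * (r%:R - 1 + \sum_i (s i)%:R) +
          (12 * n%:R ^+ 2)^-1 * (Mf - 1) +
          (24 * n%:R ^+ 2)^-1 * \sum_i (marginal m i)^-1 * A i)
       +o_\oo (fun n : nat => n%:R ^- 2 : R)) /\
  ((forall i, full_model (s i) (M i)) ->
     let p : R := (\sum_i J i)%N%:R - 1 in
     two_stage_risk phat m =
       (fun n : nat => p / (2 * n%:R) +
          (12 * n%:R ^+ 2)^-1 *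
            (\sum_(i < r) \sum_(j < J i) (m (cell j))^-1 - 1))
       +o_\oo (fun n : nat => n%:R ^- 2 : R)).
Proof.
have mu_gt0 := marginal_gt0 J_gt0 m_gt0.
have phat_simplex i x (x0 : (0 < \sum_j x j)%N) :
    (forall j, 0 <= phat i x ord0 j) /\ \sum_j phat i x ord0 j = 1.
  have [clM _] := phat_mle i x x0.
  by apply: closure_open_simplex; apply: closureS clM; exact: (M_model i).1.
have expansion (A : 'I_r -> R) :
    (forall i, negligible (fun n => stage_risk phat (conditional m i) n -
      ((s i)%:R / (2 * n%:R) + (24 * n%:R ^+ 2)^-1 * A i))) ->
  negligible (fun n => two_stage_risk phat m n -
    ((r%:R - 1 + \sum_i (s i)%:R) / (2 * n%:R) + (24 * n%:R ^+ 2)^-1 *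
            (\sum_i (marginal m i)^-1 * (A i + 2) - 2))).
  move=> stage.
  have {}stage i : negligible (fun n => stage_risk phat (conditional m i) n -
      ((s i)%:R / 2 / n%:R + A i / 24 / n%:R ^+ 2)).
    by apply: eq_negligible (stage i) => n; field; rewrite nat1r pnatr_eq0.
  apply: eq_negligible (two_stage_risk_expansion J_gt0 m_gt0 m_sum1 phat_simplex stage) => n.
  congr (_ - _).
  transitivity (\sum_i ((2 * n.+1%:R)^-1 * (1 - marginal m i + (s i)%:R) +
    (24 * n.+1%:R ^+ 2)^-1 * ((marginal m i)^-1 * (A i + 2) - 2 * marginal m i))).
    by apply: eq_bigr => i _; field; rewrite gt_eqF //= nat1r pnatr_eq0.
  rewrite big_split /= -!mulr_sumr big_split /= !sumrB -mulr_sumr marginal_sum1 //.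
  by rewrite sumr_const card_ord mulr1 mulrC.
split=> [A stage p' Mf|full p].
  have risk := expansion A (fun i => (negligibleP _ _).1 (stage i)).
  split; apply/negligibleP; first exact: risk.
  apply: eq_negligible risk => n; congr (_ - _).
  have -> : \sum_i (marginal m i)^-1 * (A i + 2) = \sum_i (marginal m i)^-1 * A i + Mf * 2.
    by rewrite mulr_suml -big_split; apply: eq_bigr => i _; rewrite mulrDr.
  by field; rewrite nat1r pnatr_eq0.
apply/negligibleP.
(* The coefficient that full_model_risk gives for the probabilities p_i. *)
pose A i : R := 2 * (\sum_j (conditional m i ord0 j)^-1 - 1).
have JE i : (J i)%:R = (J i).-1%:R + 1 :> R by rewrite natr1 prednK.
have stage i : negligible (fun n => stage_risk phat (conditional m i) n -
      ((s i)%:R / (2 * n%:R) + (24 * n%:R ^+ 2)^-1 * A i)).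
  have q0 := conditional_gt0 J_gt0 m_gt0 (i := i).
  have q1 := conditional_sum1 J_gt0 m_gt0 i.
  apply: eq_negligible (full_model_risk q0 q1) => n; congr (_ - _).
    apply: eq_multinomial_expectation => x sx; congr kl_div.
    have x0 : (0 < \sum_j x j)%N by rewrite sx.
    have := phat_mle i x x0; rewrite (full i).2 => /(mle_full_model x0) ->.
    by apply/funext => j; rewrite mxE sx.
  rewrite card_ord (full i).1 /A JE.
  by field; rewrite nat1r pnatr_eq0.
apply: eq_negligible (expansion A stage) => n; congr (_ - (_ / _ + _)).
  rewrite /p natr_sum -addrA [-1 + _]addrC addrA; congr (_ - 1).
  rewrite -[r in r%:R]card_ord -sumr_const -big_split; apply: eq_bigr => i _ /=.
  by rewrite (full i).1 JE addrC.
have -> : \sum_i (marginal m i)^-1 * (A i + 2) = 2 * \sum_(i < r) \sum_(j < J i) (m (cell j))^-1.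
  rewrite mulr_sumr; apply: eq_bigr => i _.
  have -> : A i + 2 = 2 * \sum_j (conditional m i ord0 j)^-1 by rewrite /A; ring.
  rewrite mulrCA; congr (_ * _); rewrite mulr_sumr; apply: eq_bigr => j _.
  by rewrite mxE invf_div mulrA mulVf ?mul1r // gt_eqF.
by field; rewrite nat1r pnatr_eq0.
Qed.
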